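(* Let $f:[0,1]\to\mathbb{R}$ be continuously differentiable. Then for every integer $n \ge 2$ and every $x \in [0,1]$, $$\left| B_n'[f](x) - f'(x) \right| \le \frac{3}{2}\, \omega[f']\left(\frac{1}{n}\right) + 2 \int_0^\infty \omega[f']\left(\frac{z\,\theta(x)}{\sqrt{n-1}}\right) z \exp\left(-\frac{z^2}{2}\right) dz .$$
   Context: For a continuous function $f$ on $[0,1]$ and a positive integer $n$, the Bernstein polynomial is $$B_n[f](x) = \sum_{m=0}^n \binom{n}{m} f\left(\frac{m}{n}\right) x^m (1-x)^{n-m},$$ and $B_n'[f](x)$ denotes its derivative with respect to $x$. For a continuous function $g$ on $[0,1]$, its modulus of continuity is $$\omega[g](\delta) = \sup_{x,y \in [0,1],\ |x-y| \le \delta} |g(x)-g(y)|, \quad \delta \ge 0.$$ Finally $\theta(x) = \sqrt{x(1-x)}$. *)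

(* Defs.v *)
From mathcomp Require Import all_boot all_order all_algebra.
From mathcomp Require Import all_classical all_reals all_analysis.
Set Implicit Arguments.
Unset Strict Implicit.
Unset Printing Implicit Defensive.
Import Order.TTheory GRing.Theory Num.Theory.
Import numFieldNormedType.Exports.
Local Open Scope classical_set_scope.
Local Open Scope ring_scope.

(* A function on [0, 1] is represented by a total function R -> R whose values
   outside [0, 1] play no role. *)

Definition bernstein {R : realType} (n : nat) (f : R -> R) (x : R) : R :=
  \sum_(m < n.+1) 'C(n, m)%:R * f (m%:R / n%:R) * x ^+ m * (1 - x) ^+ (n - m).

Definition modulus01 {R : realType} (g : R -> R) (delta : R) : R :=
  sup [set d | exists x y : R, [/\ x \in `[0, 1], y \in `[0, 1],
                               `|x - y| <= delta & d = `|g x - g y|]].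

(* The limit is taken along points y != x of [0, 1], so it is one-sided at the
   endpoints and does not see the values of f outside [0, 1]. *)
Definition is_derivative01 {R : realType} (f df : R -> R) : Prop :=
  forall x : R, x \in `[0, 1] ->
    (f y - f x) / (y - x) @[y --> within `[0, 1] x^'] --> df x.

Definition C1_on01 {R : realType} (f df : R -> R) : Prop :=
  is_derivative01 f df /\ {within `[0, 1], continuous df}.

Definition theta {R : realType} (x : R) : R := Num.sqrt (x * (1 - x)).

(* Main.v *)
Require Import Defs.
From mathcomp Require Import all_boot all_order all_algebra.
From mathcomp Require Import all_classical all_reals all_analysis measurable_realfun.
From mathcomp Require Import ring lra.
Import Order.TTheory GRing.Theory Num.Theory.
Import numFieldNormedType.Exports.
Local Open Scope classical_set_scope.
Local Open Scope ring_scope.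

(** The derivative of a Bernstein polynomial of degree n+1 is a binomial mean of
difference quotients: if S is a binomial variable with parameters n and x, then
[B' = E (f ((S+1)/(n+1)) - f (S/(n+1))) * (n+1)].  By the mean value theorem the
quotient at [S = m] is [f' c] for some [c] between [m/(n+1)] and [(m+1)/(n+1)];
this interval has length [1/(n+1)] and contains [m/n].  With [w] the modulus of
continuity of [f'], subadditivity of [w] gives
[|B' x - f' x| <= w (1/(n+1)) + E (w |S/n - x|)].

Let [s = theta x / sqrt n], the standard deviation of [S/n], and let [I] be the
integral of the statement, that is, the mean of [w (s Z)] for a Rayleigh
variable [Z], which has tail [P (Z >= a) = exp (- a^2/2)].  The point is that
[E (w |S/n - x|) <= 2 I] although the tails of [S/n] need not be Gaussian: only
the variance of [S/n] enters.  Since [w] is nondecreasing, restricting the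
integral to [Z >= a] gives [w (a s) exp (- a^2/2) <= I] (rayleigh_mean_ge).
Cutting [t s] into [k] equal steps, subadditivity then yields
[w (t s) <= k exp ((t/k)^2/2) I] for every [k > 0], and a suitable [k] makes the
factor at most [1 + t^2] (expR_chop).  Hence [w (t s) <= (1 + t^2) I], and taking
[t = |S/n - x| / s], whose square has mean 1, bounds the expectation by [2 I]
(binmean_modulus_le). *)

(** * Binomial means *)

Definition binmean {R : realType} (n : nat) (x : R) (g : nat -> R) : R :=
  \sum_(m < n.+1) 'C(n, m)%:R * x ^+ m * (1 - x) ^+ (n - m) * g m.

Lemma binmean0 (R : realType) (x : R) g : binmean 0 x g = g 0%N.
Proof. by rewrite /binmean big_ord1 bin0 !expr0 !mul1r. Qed.

Lemma eq_binmean (R : realType) n (x : R) g h :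
  (forall m, (m <= n)%N -> g m = h m) -> binmean n x g = binmean n x h.
Proof. by move=> gh; apply: eq_bigr => m _; rewrite gh// -ltnS. Qed.

Lemma binmeanD (R : realType) n (x : R) g h :
  binmean n x (fun m => g m + h m) = binmean n x g + binmean n x h.
Proof. by rewrite /binmean -big_split; apply: eq_bigr => m _; rewrite mulrDr. Qed.

Lemma binmeanZ (R : realType) n (x c : R) g :
  binmean n x (fun m => c * g m) = c * binmean n x g.
Proof. by rewrite /binmean big_distrr; apply: eq_bigr => m _; rewrite /= mulrCA. Qed.

Lemma binmeanB (R : realType) n (x : R) g h :
  binmean n x (fun m => g m - h m) = binmean n x g - binmean n x h.
Proof.
by rewrite -[in RHS]mulN1r -binmeanZ -binmeanD; apply: eq_binmean => m _; ring.
Qed.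

(** Conditioning on one trial.  This recursion is the only property of the
binomial weights that the mean, variance and derivative computations use. *)
Lemma binmeanS (R : realType) n (x : R) g :
  binmean n.+1 x g = x * binmean n x (g \o S) + (1 - x) * binmean n x g.
Proof.
rewrite {1}/binmean big_ord_recl bin0 expr0 subn0.
rewrite (eq_bigr (fun i : 'I_n.+1 =>
    'C(n, i.+1)%:R * x ^+ i.+1 * (1 - x) ^+ (n - i) * g i.+1 +
    'C(n, i)%:R * x ^+ i.+1 * (1 - x) ^+ (n - i) * g i.+1)); last first.
  by move=> i _; rewrite lift0 subSS binS natrD !mulrDl.
rewrite big_split /= addrA addrC; congr (_ + _).
  rewrite /binmean big_distrr; apply: eq_bigr => i _ /=.
  by rewrite exprS; ring.
rewrite /binmean [in RHS]big_ord_recl bin0 [in RHS]expr0 subn0 mulrDr; congr (_ + _).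
  by rewrite exprS; ring.
rewrite big_ord_recr/= bin_small// !mul0r addr0 big_distrr.
apply: eq_bigr => i _ /=; rewrite /bump /= ?add1n.
by rewrite -(subnSK (ltn_ord i)) (exprS (1 - x)); ring.
Qed.

Lemma binmean_cst (R : realType) n (x c : R) : binmean n x (fun=> c) = c.
Proof.
elim: n => [|n IH]; first by rewrite binmean0.
by rewrite binmeanS /comp IH; ring.
Qed.

(** The second moment about an arbitrary point [a], variance plus squared bias:
letting [a] vary is what makes the induction go through, because the recursion
shifts it by one. *)
Lemma binmean_sqr (R : realType) n (x a : R) :
  binmean n x (fun m => (m%:R - a) ^+ 2) = n%:R * (x * (1 - x)) + (n%:R * x - a) ^+ 2.
Proof.
elim: n a => [|n IH] a; first by rewrite binmean0; ring.
rewrite binmeanS IH.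
under (@eq_binmean _ _ _ (_ \o _) (fun m => (m%:R - (a - 1)) ^+ 2)).
  by move=> m _; rewrite /= -natr1; ring.
by rewrite IH -natr1; ring.
Qed.

Lemma ler_binmean (R : realType) n (x : R) g h : x \in `[0, 1] ->
  (forall m, (m <= n)%N -> g m <= h m) -> binmean n x g <= binmean n x h.
Proof.
rewrite in_itv/= => /andP[x0 x1] gh; apply: ler_sum => m _.
by rewrite ler_wpM2l ?gh// ?mulr_ge0 ?exprn_ge0 ?subr_ge0// -ltnS.
Qed.

Lemma ler_norm_binmean (R : realType) n (x : R) g : x \in `[0, 1] ->
  `|binmean n x g| <= binmean n x (fun m => `|g m|).
Proof.
rewrite in_itv/= => /andP[x0 x1]; apply: le_trans (ler_norm_sum _ _ _) _.
apply: ler_sum => m _; rewrite normrM ger0_norm//.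
by rewrite ?mulr_ge0 ?exprn_ge0 ?subr_ge0.
Qed.

Lemma binmean_at0 (R : realType) n g : binmean n (0 : R) g = g 0%N.
Proof.
elim: n => [|n IH]; first exact: binmean0.
by rewrite binmeanS IH mul0r add0r subr0 mul1r.
Qed.

Lemma binmean_at1 (R : realType) n g : binmean n (1 : R) g = g n.
Proof.
elim: n g => [|n IH] g; first exact: binmean0.
by rewrite binmeanS IH subrr mul0r addr0 mul1r.
Qed.

(** Differentiating the recursion produces the difference of two means, which is
the mean of the forward difference of [g]; the remaining terms reassemble by
the recursion one level down. *)
Lemma is_derive_binmean (R : realType) n (x : R) g :
  is_derive x 1 (fun y => binmean n y g)
    (n%:R * binmean n.-1 x (fun m => g m.+1 - g m)).
Proof.
elim: n g => [|n IH] g /=.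
  rewrite mul0r.
  rewrite [X in is_derive _ _ X _](_ : _ = cst (g 0%N)); last first.
    by apply/funext => y; rewrite binmean0.
  exact: is_derive_cst.
rewrite [X in is_derive _ _ X _](_ : _ = id * (fun y => binmean n y (g \o S)) +
    (cst 1 - id) * (fun y => binmean n y g)); last first.
  by apply/funext => y; rewrite binmeanS.
apply: is_derive_eq.
rewrite /GRing.scale/= !mulr1 sub0r mulrN1 /cst /=.
have -> : binmean n x (fun m => g m.+1 - g m)
        = binmean n x (g \o S) - binmean n x g.
  by rewrite -binmeanB.
case: n IH => [|n] IH.
  by rewrite !binmean0 !mul0r !mulr0; ring.
rewrite -[in RHS]natr1.
have E : binmean n.+1 x (g \o S) - binmean n.+1 x g
        = x * binmean n x (fun m => g m.+2 - g m.+1) +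
         (1 - x) * binmean n x (fun m => g m.+1 - g m).
  by rewrite -binmeanB binmeanS.
rewrite [in RHS]E (_ : ((fun=> 1) - id) x = 1 - x)//=; move: E; lra.
Qed.

(** * The modulus of continuity *)

Lemma continuous01_bounded (R : realType) (g : R -> R) :
  {within `[0, 1], continuous g} ->
  exists M : R, forall x, x \in `[0, 1] -> `|g x| <= M.
Proof.
move=> gc; have /= cn : {within `[0, 1], continuous (fun x => `|g x|)}.
  by move=> x; apply: cvg_norm; exact: gc.
by have [c _ cM] := EVT_max ler01 cn; exists `|g c|.
Qed.

(** Boundedness makes the supremum defining the modulus a genuine least upper
bound. *)
Section modulus.
Variables (R : realType) (g : R -> R).
Hypothesis gbd : exists M : R, forall x, x \in `[0, 1] -> `|g x| <= M.
Let w := modulus01 g.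

Lemma modulus01_ub (x y d : R) : x \in `[0, 1] -> y \in `[0, 1] ->
  `|x - y| <= d -> `|g x - g y| <= w d.
Proof.
move=> x01 y01 xyd; apply: ub_le_sup; last by exists x, y.
have [M gM] := gbd; exists (M + M) => _ [u [v [u01 v01 _ ->]]].
by rewrite (le_trans (ler_normB _ _))// lerD// gM.
Qed.

Lemma modulus01_le (d c : R) : 0 <= d ->
  (forall x y, x \in `[0, 1] -> y \in `[0, 1] -> `|x - y| <= d ->
     `|g x - g y| <= c) -> w d <= c.
Proof.
move=> d0 H; apply: ge_sup; last by move=> _ [u [v [u01 v01 uv ->]]]; exact: H.
have O : (0 : R) \in `[0, 1] by rewrite in_itv/= lexx ler01.
by exists `|g 0 - g 0|; exists 0, 0; split => //; rewrite subrr normr0.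
Qed.

(** The set of oscillations is empty here and [sup set0 = 0], so that the modulus
is monotone, hence measurable, on the whole line. *)
Lemma modulus01_lt0 (d : R) : d < 0 -> w d = 0.
Proof.
move=> d0; rewrite /w /modulus01 (_ : mkset _ = set0) ?sup0// -subset0.
by move=> y [u [v [_ _ uv _]]]; have := le_lt_trans uv d0; rewrite normr_lt0.
Qed.

Lemma modulus01_ge0 (d : R) : 0 <= w d.
Proof.
have [d0|d0] := ltP d 0; first by rewrite modulus01_lt0.
have O : (0 : R) \in `[0, 1] by rewrite in_itv/= lexx ler01.
apply: le_trans (normr_ge0 _) (modulus01_ub 0 0 d O O _).
by rewrite subrr normr0.
Qed.

Lemma modulus01_mono : {homo w : a b / a <= b}.
Proof.
move=> a b ab; have [a0|a0] := ltP a 0.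
  by rewrite modulus01_lt0// modulus01_ge0.
apply: modulus01_le => // x y x01 y01 xy.
by apply: modulus01_ub => //; exact: le_trans ab.
Qed.

Lemma modulus01_0 : w 0 = 0.
Proof.
apply/eqP; rewrite eq_le modulus01_ge0 andbT; apply: modulus01_le => // x y _ _.
by rewrite normr_le0 subr_eq0 => /eqP ->; rewrite subrr normr0.
Qed.

(** The point dividing the segment from [x] to [y] in the ratio [a : b] stays in
[[0, 1]] and is within [a] of [x] and within [b] of [y]. *)
Lemma modulus01D (a b : R) : 0 <= a -> 0 <= b -> w (a + b) <= w a + w b.
Proof.
move=> a0 b0; have [ab0|ab0] := eqVneq (a + b) 0.
  by rewrite ab0 modulus01_0 addr_ge0// modulus01_ge0.
have ab : 0 < a + b by rewrite lt_neqAle eq_sym ab0 addr_ge0.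
apply: modulus01_le; first exact: ltW.
move=> x y /[dup] x01 + /[dup] y01 + xy.
rewrite !in_itv/= => /andP[x0 x1] /andP[y0 y1].
have abi : 0 < (a + b)^-1 by rewrite invr_gt0.
pose p := a / (a + b); pose q := b / (a + b).
have p0 : 0 <= p by rewrite divr_ge0// ltW.
have q0 : 0 <= q by rewrite divr_ge0// ltW.
have pq : p + q = 1 by rewrite /p /q -mulrDl divff.
pose z := q * x + p * y.
have z01 : z \in `[0, 1] by rewrite in_itv/= /z; apply/andP; split; nra.
have -> : g x - g y = (g x - g z) + (g z - g y) by ring.
apply: le_trans (ler_normD _ _) _; apply: lerD; apply: modulus01_ub => //.
  have -> : x - z = p * (x - y) by rewrite /z (_ : q = 1 - p); [ring|lra].
  rewrite normrM ger0_norm// (le_trans (ler_wpM2l p0 xy))//.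
  by rewrite /p mulfVK.
have -> : z - y = q * (x - y) by rewrite /z (_ : p = 1 - q); [ring|lra].
rewrite normrM ger0_norm// (le_trans (ler_wpM2l q0 xy))//.
by rewrite /q mulfVK.
Qed.

Lemma modulus01Mn (a : R) k : 0 <= a -> w (k%:R * a) <= k%:R * w a.
Proof.
move=> a0; elim: k => [|k IH]; first by rewrite !mul0r modulus01_0.
rewrite -natr1 !mulrDl !mul1r.
by apply: le_trans (modulus01D _ _ _ a0) _; rewrite ?mulr_ge0// lerD2r.
Qed.

End modulus.

(** * Lower bound for a Rayleigh mean *)

Lemma integral_gauss_tail (R : realType) (a : R) : 0 <= a ->
  (\int[lebesgue_measure]_(z in `[a, +oo[) (z * expR (- (z ^+ 2 / 2)))%:E
   = (expR (- (a ^+ 2 / 2)))%:E)%E.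
Proof.
move=> a0.
pose E (z : R) := expR (- (z ^+ 2 / 2)).
have dE (z : R) : is_derive z 1 E (- (z * E z)).
  have d2 : is_derive z 1 (fun z : R => - (z ^+ 2 / 2)) (- z).
    rewrite [X in is_derive _ _ X _](_ : _ = (- 2^-1) *: (@GRing.exp R ^~ 2)).
      by apply: is_derive_eq; rewrite /GRing.scale/=; lra.
    by apply/funext => y; rewrite fctE /GRing.scale/= mulNr mulrC.
  by have := is_derive1_comp (is_derive_expR _) d2; rewrite mulrN mulrC.
have cE : continuous E.
  move=> z; apply: differentiable_continuous; apply/derivable1_diffP.
  exact: (@ex_derive _ _ _ _ _ _ _ (dE z)).
have dF (z : R) : is_derive z 1 (- E) (z * E z).
  by have := is_deriveN (dE z); rewrite opprK.
rewrite (@ge0_continuous_FTC2y _ _ (- E) a 0).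
- by rewrite sub0e -EFinN fctE opprK.
- by move=> z az; rewrite mulr_ge0 ?expR_ge0// (le_trans a0).
- apply: continuous_subspaceT => z; apply: cvgM; first exact: cvg_id.
  exact: cE.
- rewrite -oppr0; apply: cvgN.
  apply: (@squeeze_cvgr _ _ _ _ (cst 0) (fun z => expR (1/2 - z))).
  (* [z^2/2 >= z - 1/2] reduces the limit to that of [expR (- z)] *)
  + near=> z; rewrite expR_ge0/= ler_expR.
    by have := sqr_ge0 (z - 1); lra.
  + exact: cvg_cst.
  + rewrite (_ : (fun z => _) = (fun z => expR (1/2) * expR (- z))); last first.
      by apply/funext => z; rewrite expRD.
    by rewrite -(mulr0 (expR (1/2))); apply: cvgM; [exact: cvg_cst|exact: cvgr_expR].
- by move=> z az; exact: (@ex_derive _ _ _ _ _ _ _ (dF z)).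
- by apply: cvg_at_right_filter; apply: cvgN; exact: cE.
- by move=> z _; rewrite derive1E; exact: derive_val.
Unshelve. all: by end_near. Qed.

(** Markov's inequality: on [z >= a] the monotone function [v] is at least
[v (a * s)], and that half-line has mass [expR (- (a ^+ 2 / 2))]. *)
Lemma rayleigh_mean_ge (R : realType) (v : R -> R) (s a : R) (I : R) :
  0 <= s -> 0 <= a -> (forall t, 0 <= v t) -> {homo v : x y / x <= y} ->
  (\int[lebesgue_measure]_(z in `[0%R, +oo[)
       (v (z * s) * z * expR (- (z ^+ 2 / 2)))%:E <= I%:E)%E ->
  v (a * s) * expR (- (a ^+ 2 / 2)) <= I.
Proof.
move=> s0 a0 v0 vm; rewrite -lee_fin; apply: le_trans.
have mg (D : set R) : measurable_fun D (fun z : R => z * expR (- (z ^+ 2 / 2))).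
  apply: measurable_funTS; apply: measurable_funM => //.
  apply: measurableT_comp => //; apply: measurableT_comp => //.
  by apply: measurable_funM => //; exact: exprn_measurable.
have mv (D : set R) : measurable D ->
    measurable_fun D (fun z : R => (v (z * s) * z * expR (- (z ^+ 2 / 2)))%:E).
  move=> mD; apply/measurable_EFinP.
  under eq_fun do rewrite -mulrA.
  apply: measurable_funM; last exact: mg.
  by apply: nondecreasing_measurable => // x y xy; apply: vm; rewrite ler_wpM2r.
have sub : [set` `[a, +oo[] `<=` [set` `[(0:R), +oo[].
  by move=> z; rewrite /= !in_itv/= !andbT; exact: le_trans.
have m0 : measurable [set` `[(0:R), +oo[] by exact: measurable_itv.
have ma : measurable [set` `[a, +oo[] by exact: measurable_itv.
apply: le_trans (ge0_subset_integral lebesgue_measure ma m0 (mv _ m0) _ sub);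
    last first.
  move=> z; rewrite /= in_itv/= andbT => z0.
  by rewrite lee_fin !mulr_ge0 ?expR_ge0.
have mc : measurable_fun [set` `[a, +oo[]
    (fun z : R => (v (a * s) * (z * expR (- (z ^+ 2 / 2))))%:E).
  apply/measurable_EFinP; apply: measurable_funM; last exact: mg.
  exact: measurable_cst.
have <- : (\int[lebesgue_measure]_(z in `[a, +oo[)
    (v (a * s) * (z * expR (- (z ^+ 2 / 2))))%:E
    = (v (a * s) * expR (- (a ^+ 2 / 2)))%:E)%E.
  rewrite [RHS]EFinM -integral_gauss_tail// -ge0_integralZl_EFin//.
    by move=> z; rewrite /= in_itv/= andbT => z0;
      rewrite lee_fin !mulr_ge0 ?expR_ge0// (le_trans a0).
  by apply/measurable_EFinP; exact: mg.
apply: ge0_le_integral => //.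
- move=> z; rewrite /= in_itv/= andbT => z0.
  by rewrite lee_fin !mulr_ge0 ?expR_ge0// (le_trans a0).
- exact: (mv _ ma).
- move=> z; rewrite /= in_itv/= andbT => az; rewrite lee_fin -mulrA.
  rewrite ler_wpM2r ?mulr_ge0 ?expR_ge0 ?(le_trans a0)//.
  by apply: vm; rewrite ler_wpM2r.
Qed.

(** * Trading Gaussian growth for quadratic growth *)

Lemma expR_le_invB (R : realType) (u : R) : u < 1 -> expR u <= (1 - u)^-1.
Proof.
move=> u1; rewrite -[u]opprK expRN lef_pV2 ?posrE ?expR_gt0//; last by lra.
by have := expR_ge1Dx (- u); rewrite opprK.
Qed.

(** With [s = t ^+ 2], the bound [expR u <= (1 - u)^-1] settles both [k = 1]
(after squaring, at [u = s / 4]) and [k = 2] (at [u = s / 8]); each reduces to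
the sign of the same polynomial [s ^+ 2 - 7 * s + 8], with opposite signs, so
that together they cover all [s] up to its larger root, about 5.56.  Beyond,
steps of length at most 1, i.e. [k] just above [t], cost a factor at most
[expR (1 / 2) <= 16 / 9] and [k] grows only linearly in [t]. *)
Lemma expR_chop (R : realType) (t : R) : 0 <= t ->
  exists2 k, (0 < k)%N & k%:R * expR ((t / k%:R) ^+ 2 / 2) <= 1 + t ^+ 2.
Proof.
move=> t0.
have sq (u : R) : u < 1 -> expR (u *+ 2) <= ((1 - u)^-1) ^+ 2.
  move=> u1; rewrite mulr2n expRD -expr2 lerXn2r ?nnegrE ?expR_ge0//.
    by rewrite invr_ge0; lra.
  exact: expR_le_invB.
have s0 := sqr_ge0 t; set s := t ^+ 2 in s0 *.
have [P|P] := leP 0 (s ^+ 2 - 7 * s + 8); last first.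
  exists 2%N => //.
  have s8 : s < 8 by nra.
  have := @expR_le_invB R ((t / 2) ^+ 2 / 2).
  have -> : (t / 2) ^+ 2 / 2 = s / 8 by rewrite /s; field.
  move=> /(_ ltac:(lra)) H.
  apply: le_trans (ler_wpM2l _ H) _ => //.
  rewrite ler_pdivrMr; last by lra.
  nra.
have [s2|s2] := leP s 2.
  exists 1%N => //; rewrite mul1r divr1 -/s.
  have -> : s / 2 = (s / 4) *+ 2 by lra.
  apply: le_trans (sq _ _) _; first by lra.
  rewrite exprVn invf_ple ?posrE; last 2 first.
  - by rewrite exprn_gt0//; lra.
  - by lra.
  rewrite -[X in X <= _]mul1r ler_pdivrMr; last by lra.
  have : 0 <= s * (s ^+ 2 - 7 * s + 8) by rewrite mulr_ge0.
  nra.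
have s3 : 27 / 5 < s by nra.
have t3 : 23 / 10 < t by rewrite /s in s3; nra.
have /andP[kt tk] := truncn_itv t0; set k := (Num.truncn t).+1 in tk *.
have k0 : 0 < k%:R :> R by rewrite ltr0n.
exists k => //.
have H : expR ((t / k%:R) ^+ 2 / 2) <= 16 / 9.
  have -> : 16 / 9 = ((1 - 1 / 4)^-1) ^+ 2 :> R by field.
  apply: le_trans (sq _ _); last by lra.
  rewrite ler_expR.
  have : t / k%:R <= 1 by rewrite ler_pdivrMr// mul1r ltW.
  have : 0 <= t / k%:R by rewrite divr_ge0// ltW.
  move: (t / _) => y; nra.
apply: le_trans (ler_wpM2l (ltW k0) H) _.
have : k%:R <= t + 1 by rewrite /k -natr1 lerD2r.
by have := sqr_ge0 (t - 23 / 10); rewrite /s; lra.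
Qed.

(** * The mean value theorem on the unit interval *)

Lemma is_derivative01_near (R : realType) (f df : R -> R) (z e : R) :
  is_derivative01 f df -> z \in `[0, 1] -> 0 < e ->
  \forall y \near z, y \in `[0, 1] -> y != z ->
    `|df z - (f y - f z) / (y - z)| < e.
Proof.
move=> hf z01 e0; have /cvgrPdist_lt/(_ _ e0) := hf _ z01.
by rewrite !near_withinE; apply: filterS => y H y01 yz; apply: H.
Qed.

(** Near an interior point, restricting the difference quotient to [[0, 1]] is no
restriction. *)
Lemma is_derivative01_interior (R : realType) (f df : R -> R) (z : R) :
  is_derivative01 f df -> z \in `]0, 1[ -> is_derive z 1 f (df z).
Proof.
move=> hf z01.
have z01' : z \in `[0, 1] by move: z01; apply: subset_itvW.
have D : h^-1 *: (f (h *: 1 + z) - f z) @[h --> 0^'] --> df z.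
  apply/cvgrPdist_lt => e e0; rewrite near_withinE.
  have H : nbhs (0 : R) [set h | (h + z \in `]0, 1[) /\
      (h + z \in `[0, 1] -> h + z != z ->
        `|df z - (f (h + z) - f z) / (h + z - z)| < e)].
    have c0 : h + z @[h --> (0:R)] --> z.
      rewrite -[X in _ --> X]add0r; apply: cvgD; [exact: cvg_id|exact: cvg_cst].
    exact: (filterI (c0 _ (near_in_itvoo z01))
                    (c0 _ (is_derivative01_near _ _ _ _ _ hf z01' e0))).
  apply: filterS H => h [hz H] h0.
  rewrite /GRing.scale/= mulr1 mulrC.
  have := H _ _; rewrite addrK; apply; first exact: subset_itvW hz.
  by rewrite -subr_eq0 addrK.
split; first by apply/cvg_ex; exists (df z).
exact: cvg_lim D.
Qed.

Lemma is_derivative01_continuous (R : realType) (f df : R -> R) :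
  is_derivative01 f df -> {within `[0, 1], continuous f}.
Proof.
move=> hf; apply/subspace_continuousP => z z01; apply/cvgrPdist_lt => e e0.
rewrite near_withinE.
have K0 : 0 < `|df z| + 1 by rewrite ltr_wpDl.
near=> y => y01; have [->|yz] := eqVneq y z; first by rewrite subrr normr0.
have Q : `|df z - (f y - f z) / (y - z)| < 1.
  by move: y01 yz; near: y; exact: is_derivative01_near.
have yz0 : y - z != 0 by rewrite subr_eq0.
have -> : f z - f y = - ((f y - f z) / (y - z)) * (y - z) by rewrite mulNr divfK// opprB.
have q : `|(f y - f z) / (y - z)| <= `|df z| + 1.
  rewrite -[X in `|X|](subrK (df z)) addrC (le_trans (ler_normD _ _))// lerD2l.
  by rewrite distrC ltW.
rewrite normrM normrN (le_lt_trans (ler_wpM2r _ q))// mulrC -ltr_pdivlMr// distrC.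
near: y; apply: cvgr_dist_lt; [exact: cvg_id|exact: divr_gt0].
Unshelve. all: by end_near. Qed.

Lemma mean_value01 (R : realType) (f df : R -> R) (a b : R) :
  is_derivative01 f df -> 0 <= a -> a < b -> b <= 1 ->
  exists2 c, c \in `]a, b[ & f b - f a = df c * (b - a).
Proof.
move=> hf a0 ab b1; apply: MVT => //.
  move=> z zab; apply: is_derivative01_interior => //.
  by move: zab; rewrite !in_itv/= => /andP[? ?]; apply/andP; split; lra.
apply: continuous_subspaceW (is_derivative01_continuous _ _ _ hf).
by apply: subset_itvScc; rewrite bnd_simp.
Qed.

(** * The Bernstein estimate *)

Lemma bernsteinE (R : realType) n (f : R -> R) :
  bernstein n f = fun x => binmean n x (fun m => f (m%:R / n%:R)).
Proof. by apply/funext => x; apply: eq_bigr => m _; ring. Qed.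

Lemma derive1_bernstein (R : realType) n (f : R -> R) (x : R) :
  derive1 (bernstein n.+1 f) x =
  binmean n x (fun m => n.+1%:R * (f (m.+1%:R / n.+1%:R) - f (m%:R / n.+1%:R))).
Proof.
rewrite derive1E bernsteinE binmeanZ.
exact: (@derive_val _ _ _ _ _ _ _ (is_derive_binmean _ n.+1 x _)).
Qed.

(** [m / n] lies between [m / n.+1] and [m.+1 / n.+1], as does the mean value
point: this is why the increments of the degree [n.+1] polynomial are compared
with the frequencies [m / n] of [n] trials. *)
Lemma bernstein_slope (R : realType) (f df : R -> R) n m :
  is_derivative01 f df -> (0 < n)%N -> (m <= n)%N ->
  exists c : R, [/\ c \in `[0, 1], `|c - m%:R / n%:R| <= 1 / n.+1%:R &
    n.+1%:R * (f (m.+1%:R / n.+1%:R) - f (m%:R / n.+1%:R)) = df c].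
Proof.
move=> hf n0 mn.
have n0R : 0 < n%:R :> R by rewrite ltr0n.
have n1 : 0 < n.+1%:R :> R by rewrite ltr0n.
have mnR : m%:R <= n%:R :> R by rewrite ler_nat.
have m0 : 0 <= m%:R :> R by rewrite ler0n.
have nS : n.+1%:R = n%:R + 1 :> R by rewrite -natr1.
have mS : m.+1%:R = m%:R + 1 :> R by rewrite -natr1.
have ab : m.+1%:R / n.+1%:R - m%:R / n.+1%:R = 1 / n.+1%:R :> R.
  by rewrite -mulrBl mS addrC addKr.
have [|||c cI fc] := @mean_value01 R f df (m%:R / n.+1%:R) (m.+1%:R / n.+1%:R) hf.
- by rewrite divr_ge0// ltW.
- by rewrite ltr_pM2r ?invr_gt0// mS ltrDl.
- by rewrite ler_pdivrMr// mul1r ler_nat.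
exists c; have a0 : 0 <= m%:R / n.+1%:R :> R by rewrite divr_ge0// ltW.
have b1 : m.+1%:R / n.+1%:R <= 1 :> R by rewrite ler_pdivrMr// mul1r ler_nat.
move: cI; rewrite in_itv/= => /andP[ac cb].
split.
- by rewrite in_itv/= (le_trans a0 (ltW ac)) (le_trans (ltW cb) b1).
- have l : m%:R / n.+1%:R <= m%:R / n%:R :> R.
    by rewrite ler_wpM2l// lef_pV2// ler_nat.
  have u : m%:R / n%:R <= m.+1%:R / n.+1%:R :> R.
    rewrite ler_pdivrMr// mulrAC ler_pdivlMr// nS mS; nra.
  move: ab ac cb l u; move: (_ / _) (_ / _) (_ / _) (1 / _) => q p r e.
  by move=> *; rewrite ler_norml; apply/andP; split; lra.
- by rewrite fc ab; field; rewrite lt0r_neq0.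
Qed.

(** The passage from exponential tails to a bound that a second moment can
absorb. *)
Lemma modulus01_le_chop (R : realType) (g : R -> R) (s t I : R) :
  (exists M : R, forall x, x \in `[0, 1] -> `|g x| <= M) ->
  0 <= s -> 0 <= t ->
  (forall a, 0 <= a -> modulus01 g (a * s) * expR (- (a ^+ 2 / 2)) <= I) ->
  modulus01 g (t * s) <= (1 + t ^+ 2) * I.
Proof.
move=> gM s0 t0 HI.
have I0 : 0 <= I.
  apply: le_trans (HI 0 (lexx _)).
  by rewrite mulr_ge0 ?expR_ge0// modulus01_ge0.
have [k k0 Hk] := expR_chop _ _ t0.
have k0R : 0 < k%:R :> R by rewrite ltr0n.
have tk0 : 0 <= t / k%:R by rewrite divr_ge0// ltW.
apply: le_trans (ler_wpM2r I0 Hk).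
have -> : t * s = k%:R * (t / k%:R * s) by field; rewrite lt0r_neq0.
apply: le_trans (modulus01Mn _ _ gM _ _ _) _; first by rewrite mulr_ge0.
rewrite -[leRHS]mulrA ler_wpM2l ?(ltW k0R)//.
have := HI _ tk0; rewrite expRN ler_pdivrMr ?expR_gt0//.
by rewrite [I * _]mulrC.
Qed.

(** A Chebyshev-type argument: integrating the quadratic bound uses only that
[s ^+ 2] is the variance of the frequency.  At the endpoints [s = 0], but the
frequency is then deterministic. *)
Lemma binmean_modulus_le (R : realType) (g : R -> R) n (x s I : R) :
  (exists M : R, forall x, x \in `[0, 1] -> `|g x| <= M) ->
  (0 < n)%N -> x \in `[0, 1] ->
  s = theta x / Num.sqrt n%:R ->
  (forall a, 0 <= a -> modulus01 g (a * s) * expR (- (a ^+ 2 / 2)) <= I) ->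
  binmean n x (fun m => modulus01 g `|m%:R / n%:R - x|) <= 2 * I.
Proof.
move=> gM n0 x01 sE HI.
have n0R : 0 < n%:R :> R by rewrite ltr0n.
have /andP[x0 x1] : 0 <= x <= 1 by rewrite in_itv/= in x01.
have I0 : 0 <= I.
  apply: le_trans (HI 0 (lexx _)).
  by rewrite mulr_ge0 ?expR_ge0// modulus01_ge0.
have xx0 : 0 <= x * (1 - x) by rewrite mulr_ge0// subr_ge0.
have [xx|xx] := eqVneq (x * (1 - x)) 0.
  have /orP[/eqP ->|/eqP ->] : (x == 0) || (x == 1).
  - by move/eqP: xx; rewrite mulf_eq0 subr_eq0 [1 == x]eq_sym.
  - by rewrite binmean_at0 mul0r subrr normr0 modulus01_0// mulr_ge0.
  - by rewrite binmean_at1 divff ?lt0r_neq0// subrr normr0 modulus01_0// mulr_ge0.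
have s2 : s ^+ 2 = x * (1 - x) / n%:R.
  by rewrite sE expr_div_n !sqr_sqrtr// ltW.
have s0 : 0 < s.
  by rewrite sE divr_gt0// sqrtr_gt0// lt_neqAle eq_sym xx.
(* the quadratic bound at [t = d / s], rewritten in the centred count *)
have step m : (m <= n)%N -> modulus01 g `|m%:R / n%:R - x| <=
    I + I / (n%:R ^+ 2 * s ^+ 2) * (m%:R - n%:R * x) ^+ 2.
  move=> _; set d := `|_|.
  have -> : d = d / s * s by rewrite divfK// lt0r_neq0.
  apply: le_trans (modulus01_le_chop _ _ _ _ I gM (ltW s0) _ HI) _.
    by apply: divr_ge0; [exact: normr_ge0|exact: ltW].
  rewrite expr_div_n /d -normrX ger0_norm ?sqr_ge0// mulrDl mul1r lerD2l.
  by rewrite le_eqVlt; apply/orP; left; apply/eqP; field; rewrite !lt0r_neq0.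
apply: le_trans (ler_binmean _ _ _ _ _ x01 step) _.
rewrite binmeanD binmean_cst binmeanZ binmean_sqr subrr expr0n/= addr0 s2.
rewrite le_eqVlt; apply/orP; left; apply/eqP; field.
by rewrite lt0r_neq0//=; move: xx; rewrite mulf_eq0 negb_or => /andP[-> ->].
Qed.

Theorem theorem4p1 (R : realType) (f df : R -> R) (hf : C1_on01 f df)
    (n : nat) (hn : (2 <= n)%N) (x : R) (hx : x \in `[0, 1]) :
  (`| derive1 (bernstein n f) x - df x |%:E <=
     (3 / 2 * modulus01 df (1 / n%:R))%:E +
     2%:E * \int[lebesgue_measure]_(z in `[0%R, +oo[)
       (modulus01 df (z * theta x / Num.sqrt (n%:R - 1)) * z
          * expR (- (z ^+ 2 / 2)))%:E)%E.
Proof.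
case: hf => hf /continuous01_bounded gM; case: n hn => // n n0; rewrite ltnS in n0.
have -> : n.+1%:R - 1 = n%:R :> R by rewrite -natr1 addrK.
pose s := theta x / Num.sqrt n%:R.
have s0 : 0 <= s by rewrite divr_ge0// sqrtr_ge0.
under eq_integral do rewrite -[_ * theta x / _]mulrA -/s.
set J := (\int[_]_(_ in _) _)%E.
have J0 : (0 <= J)%E.
  apply: integral_ge0 => z; rewrite /= in_itv/= andbT => z0.
  by rewrite lee_fin !mulr_ge0 ?expR_ge0// modulus01_ge0.
(* an infinite integral makes the right-hand side infinite *)
case EJ : J J0 => [I| |] // J0; last first.
  by rewrite mulry gtr0_sg// mul1e addey// leey.
have HI a : 0 <= a -> modulus01 df (a * s) * expR (- (a ^+ 2 / 2)) <= I.
  move=> a0; apply: rayleigh_mean_ge => //.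
  - by move=> t; exact: modulus01_ge0.
  - exact: modulus01_mono.
  - by rewrite -/J EJ.
rewrite -EFinM -EFinD lee_fin derive1_bernstein -[df x](binmean_cst _ n x) -binmeanB.
apply: le_trans (ler_norm_binmean _ _ _ _ hx) _.
apply: (@le_trans _ _ (modulus01 df (1 / n.+1%:R) + 2 * I)); last first.
  by have := modulus01_ge0 _ _ gM (1 / n.+1%:R); lra.
rewrite -[modulus01 df _](binmean_cst _ n x).
apply: le_trans (lerD (lexx _) (binmean_modulus_le _ _ _ x s I gM n0 hx erefl HI)).
rewrite -binmeanD; apply: ler_binmean => // m mn.
have [c [c01 cm ->]] := bernstein_slope _ _ _ _ _ hf n0 mn.
apply: le_trans (modulus01D _ _ gM _ _ _ _) => //.
apply: modulus01_ub => //.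
have -> : c - x = (c - m%:R / n%:R) + (m%:R / n%:R - x) by ring.
by apply: le_trans (ler_normD _ _) _; rewrite lerD2r.
Qed.
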